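(* Let $(\mu_k)_{k\in\mathbb{N}}$ be a sequence of measures on $\mathbb{N}$ of type $c_0$, and let $\varphi=\sup_k\mu_k$ be a (nonpathological) lower semicontinuous submeasure on $\mathbb{N}$. The following are equivalent: (i) $\mathcal{R}\leq_K\mathrm{FIN}(\varphi)$. (ii) $\mathrm{FIN}(\varphi)$ is tall. (iii) $\lim_n\mu_k(\{n\})=0$ for all $k$, and $\sup_n\varphi(\{n\})<\infty$.
   Context: A lower semicontinuous submeasure on $\mathbb{N}$ is a function $\varphi:\mathcal{P}(\mathbb{N})\to[0,\infty]$ with $\varphi(\emptyset)=0$, $\varphi(A)\leq\varphi(A\cup B)\leq\varphi(A)+\varphi(B)$, $\varphi(\{n\})<\infty$ for all $n$, and $\varphi(A)=\lim_{n\to\infty}\varphi(A\cap\{0,\dots,n\})$. $\mathrm{FIN}(\varphi)=\{A\subseteq\mathbb{N}:\varphi(A)<\infty\}$. Measures are $\sigma$-additive measures on $\mathcal{P}(\mathbb{N})$. A lower semicontinuous submeasure is nonpathological if it is the supremum of the measures it dominates. A sequence of measures $(\mu_k)_k$ on $\mathbb{N}$ is of type $c_0$ if $\lim_k\mu_k(\{n\})=0$ for all $n$. A family of subsets of $\mathbb{N}$ is tall if every infinite subset of $\mathbb{N}$ contains an infinite set in the family. $\mathcal{R}$ is the random ideal: the ideal on $\mathbb{N}$ generated by the cliques and independent sets of the random (Rado) graph on $\mathbb{N}$. $\mathcal{I}\leq_K\mathcal{J}$ (Katětov order) means there is $f:\mathbb{N}\to\mathbb{N}$ with $f^{-1}(A)\in\mathcal{J}$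 for all $A\in\mathcal{I}$. *)

(* Defs.v *)
From HB Require Import structures.
From mathcomp Require Export all_boot all_order all_algebra.
From mathcomp Require Export all_classical all_reals all_analysis.

Set Implicit Arguments.
Unset Strict Implicit.
Unset Printing Implicit Defensive.

Import Order.TTheory GRing.Theory Num.Theory.
Import numFieldNormedType.Exports.

Local Open Scope classical_set_scope.
Local Open Scope ring_scope.

(* In the library's measurable structure on nat every set is measurable, so
   {measure set nat -> \bar R} is the type of sigma-additive [0, +oo]-valued
   measures on the full power set of nat. *)

Record lsc_submeasure (R : realType) (phi : set nat -> \bar R) : Prop := {
  lscs_ge0 : forall A, (0 <= phi A)%E ;
  lscs_set0 : phi set0 = 0%E ;
  lscs_le : forall A B, (phi A <= phi (A `|` B))%E ;
  lscs_subadd : forall A B, (phi (A `|` B) <= phi A + phi B)%E ;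
  lscs_fin : forall n, (phi [set n] < +oo)%E ;
  lscs_cvg : forall A,
    phi (A `&` [set i | (i <= n)%N]) @[n --> \oo] --> phi A
}.

Definition nonpathological (R : realType) (phi : set nat -> \bar R) : Prop :=
  forall A, phi A = ereal_sup
    [set nu A | nu in [set nu : {measure set nat -> \bar R} |
                         forall B, (nu B <= phi B)%E]].

Definition FIN (R : realType) (phi : set nat -> \bar R) : set (set nat) :=
  [set A | (phi A < +oo)%E].

Definition type_c0 (R : realType) (mu : {measure set nat -> \bar R}^nat) :
    Prop :=
  forall n, mu k [set n] @[k --> \oo] --> 0%E.

Definition sup_measure (R : realType) (mu : {measure set nat -> \bar R}^nat)
    (A : set nat) : \bar R :=
  ereal_sup (range (fun k => mu k A)).

Definition tall (F : set (set nat)) : Prop :=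
  forall X, infinite_set X -> exists A, [/\ A `<=` X, infinite_set A & F A].

(* Up to isomorphism, the random graph is the unique graph on nat with the
   extension property [rg_ext]. *)
Record random_graph (E : rel nat) : Prop := {
  rg_sym : symmetric E ;
  rg_irr : irreflexive E ;
  rg_ext : forall A B : set nat, finite_set A -> finite_set B ->
    A `&` B = set0 ->
    exists v, [/\ ~ A v, ~ B v, forall a, A a -> E v a &
                  forall b, B b -> ~~ E v b]
}.

Definition clique (E : rel nat) (C : set nat) : Prop :=
  forall x y, C x -> C y -> x <> y -> E x y.

Definition independent (E : rel nat) (C : set nat) : Prop :=
  forall x y, C x -> C y -> ~~ E x y.

Record is_ideal (I : set (set nat)) : Prop := {
  ideal_finite : forall A, finite_set A -> I A ;
  ideal_subset : forall A B, A `<=` B -> I B -> I A ;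
  ideal_union : forall A B, I A -> I B -> I (A `|` B)
}.

Definition random_ideal (E : rel nat) : set (set nat) :=
  smallest is_ideal [set C | clique E C \/ independent E C].

Definition katetov_le (I J : set (set nat)) : Prop :=
  exists f : nat -> nat, forall A, I A -> J (f @^-1` A).

(* A supremum of measures is automatically nonpathological. *)
Lemma sup_measure_nonpathological (R : realType)
    (mu : {measure set nat -> \bar R}^nat) :
  nonpathological (sup_measure mu).
Proof.
move=> A; apply/eqP; rewrite eq_le; apply/andP; split.
  apply: ge_ereal_sup => _ [k _ <-]; apply: ereal_sup_ubound.
  by exists (mu k) => // B; apply: ereal_sup_ubound; exists k.
by apply: ge_ereal_sup => _ [nu nu_le <-]; exact: nu_le.
Qed.

Definition bit (m n : nat) : bool := odd (n %/ 2 ^ m)%N.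

Lemma bit_sum (b : nat -> bool) (N m : nat) : (m < N)%N ->
  bit m (\sum_(i < N) b i * 2 ^ i)%N = b m.
Proof.
rewrite /bit; elim: m N b => [|m IH] [//|N] b mN; rewrite big_ord_recl /=.
all: under eq_bigr => i _ do rewrite /bump /= add1n expnS mulnCA.
all: rewrite -big_distrr /= expn0 muln1.
  by rewrite divn1 oddD oddM /= addbF; case: (b 0%N).
rewrite expnS divnMA addnC mulnC divnMDl // (@divn_small (b 0%N)); last first.
  by case: (b 0%N).
by rewrite addn0 (IH N (fun i => b i.+1)).
Qed.

(* The graph of the Ackermann coding: for x < y, x and y are adjacent when the
   x-th binary digit of y is 1. *)
Definition ackermann_graph : rel nat := fun x y =>
  ((x < y) && bit x y || (y < x) && bit y x)%N.

Lemma ackermann_random_graph : random_graph ackermann_graph.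
Proof.
split.
- by move=> x y; rewrite /ackermann_graph orbC.
- by move=> x; rewrite /ackermann_graph ltnn.
move=> A B finA finB AB0.
have [N ubN] : exists N, forall x, (A `|` B) x -> (x < N)%N.
  have /finite_fsetP[F FE] : finite_set (A `|` B) by rewrite finite_setU.
  exists (\max_(x <- finmap.enum_fset F) x).+1 => x; rewrite FE /= => xF.
  by rewrite ltnS; apply: (@leq_bigmax_seq _ _ xpredT id).
pose b i := (i \in A) || (i == N).
pose v := (\sum_(i < N.+1) b i * 2 ^ i)%N.
have Nv : (N < v)%N.
  rewrite /v big_ord_recr /= /b eqxx orbT mul1n.
  by rewrite (leq_trans (ltn_expl N (ltnSn 1))) // leq_addl.
have adj x : (A `|` B) x -> ackermann_graph v x = (x \in A).
  move=> /ubN xN; have xv := ltn_trans xN Nv.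
  rewrite /ackermann_graph xv ltnNge (ltnW xv) /= /v bit_sum; last exact: ltnW.
  by rewrite /b (ltn_eqF xN) orbF.
exists v; split.
- by move=> Av; have := ubN v (or_introl Av); rewrite ltnNge (ltnW Nv).
- by move=> Bv; have := ubN v (or_intror Bv); rewrite ltnNge (ltnW Nv).
- by move=> a Aa; rewrite adj; [rewrite inE | left].
- move=> c Bc; rewrite adj; last by right.
  by apply/negP; rewrite inE => Ac; have : set0 c by rewrite -AB0.
Qed.

(* Main.v *)
Require Import Defs.
From mathcomp Require Import all_boot all_order all_algebra.
From mathcomp Require Import all_classical all_reals all_analysis.
From mathcomp Require Import lra.

(** Write (i), (ii), (iii) for the Katetov reduction, tallness, and the
    condition on the masses of points. The implications close up in a cycle.

    (i) -> (ii). Ramsey's theorem says that the random ideal is tall, and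
    tallness passes upwards along the Katetov order ([random_ideal_tall],
    [katetov_le_tall]).

    (ii) -> (iii). If (iii) fails, some infinite X has all its points of mass
    at least e > 0 for a single mu_k, or is a sequence of points along which
    phi tends to infinity; in both cases phi is infinite on every infinite
    subset of X ([tall_vanishing], [tall_bounded]).

    (iii) -> (i). Since every countable graph embeds in the random graph, it
    is enough to colour the pairs m < n with two colours so that all
    homogeneous sets have finite phi ([random_ideal_katetov_le]). Colour m < n
    tame when every mu_k with mu_k{m} > 2^-m satisfies mu_k{n} <= 2^-m.

    Let H be homogeneous of the tame colour and fix k. The points h of H with
    mu_k{h} <= 2^-h contribute at most 2 to mu_k(H). Among the remaining
    points, the first one has mass at most M = sup_n phi{n}, and each later
    one has mass at most 2^-h, where h is its predecessor; they contribute at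
    most M + 2. Hence phi(H) <= M + 4 ([tame_homogeneous_bound]).

    A homogeneous set of the other colour is finite: given an element
    m of it, only finitely many k have mu_k{m} > 2^-m, because the sequence is of
    type c_0, and each of these mu_k has only finitely many points of mass
    above 2^-m, so only finitely many n > m are joined to m by this colour
    ([wild_homogeneous_finite]). *)

Import Order.TTheory GRing.Theory Num.Theory.
Import numFieldNormedType.Exports.

Local Open Scope classical_set_scope.
Local Open Scope ring_scope.

(** * Infinite sets of natural numbers *)

Lemma finite_natP (X : set nat) : finite_set X <-> exists N, X `<=` `I_N.
Proof.
split=> [/finite_seqP[s ->]|[N XN]]; last first.
  exact: sub_finite_set XN (finite_II N).
exists (\max_(x <- s) x).+1 => x /= xs.
by rewrite ltnS; apply: (@leq_bigmax_seq _ _ xpredT id).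
Qed.

Lemma infinite_nat_ge {X : set nat} (N : nat) :
  infinite_set X -> exists2 x, X x & (N <= x)%N.
Proof.
move=> /(@infinite_setD _ _ `I_N) /(_ (finite_II N)) /infinite_setN0[x [Xx]].
by move=> /negP; rewrite -leqNgt; exists x.
Qed.

(** Both the type c_0 condition and the vanishing of the masses of points are
    used only in this combinatorial form. *)
Lemma cvge0_finiteP {R : realType} {u : nat -> \bar R} :
  (forall n, 0 <= u n)%E ->
  u n @[n --> \oo] --> 0%E <->
  forall e : R, 0 < e -> finite_set [set n | (e%:E <= u n)%E].
Proof.
move=> u0; split=> [/fine_cvgP[ufin /cvgr0Pnorm_lt ucvg] e e0|ufin].
  have [N _ uN] : \forall n \near \oo, (u n < e%:E)%E.
    near=> n; have un : u n \is a fin_num by near: n.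
    rewrite -(fineK un) lte_fin (le_lt_trans (ler_norm _))//.
    by near: n; exact: ucvg.
  apply/finite_natP; exists N => n /=; apply: contraTT; rewrite -leqNgt -ltNge.
  exact: uN.
have small (e : R) : 0 < e -> \forall n \near \oo, (u n < e%:E)%E.
  move=> /ufin/finite_natP[N uN]; near=> n; rewrite ltNge; apply/negP => /uN /=.
  by apply/negP; rewrite -leqNgt; near: n; exact: nbhs_infty_ge.
apply/fine_cvgP; split.
  near=> n; rewrite ge0_fin_numE// (lt_trans _ (ltry 1))//.
  by near: n; exact: small.
apply/cvgr0Pnorm_lt => e e0; near=> n.
have une : (u n < e%:E)%E by near: n; exact: small.
have un : u n \is a fin_num by rewrite ge0_fin_numE// (lt_trans une) ?ltry.
by rewrite /= ger0_norm ?fine_ge0// -lte_fin fineK.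
Unshelve. all: by end_near. Qed.

(** Course-of-values dependent choice: [mkseq f n] is the list of the values
    chosen before stage n. Invariants of the construction are put into [P] as
    premises on the list. *)
Lemma history_choice {P : seq nat -> nat -> Prop} :
  (forall s, exists v, P s v) -> exists f, forall n, P (mkseq f n) (f n).
Proof.
move=> /choice[g gP].
pose hist n := iter n (fun s => rcons s (g s)) [::].
exists (fun n => g (hist n)) => n.
suff -> : mkseq (fun n => g (hist n)) n = hist n by exact: gP.
by elim: n => // n IH; rewrite mkseqS IH.
Qed.

(** * Ramsey's theorem and the random ideal *)

(** Fix an ultrafilter U that contains X and all final segments of nat. For
    each x, U decides the colour of (x, y) for almost all y, and this limit
    colour is a constant b for almost all x. Points with limit colour b can be
    chosen one after another, since the constraints imposed by finitely many
    of them hold on a set of U. *)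
Lemma ramsey_pairs (c : rel nat) (X : set nat) : infinite_set X ->
  exists Y b, [/\ Y `<=` X, infinite_set Y &
                  forall x y, Y x -> Y y -> (x < y)%N -> c x y = b].
Proof.
move=> Xinf.
(* The trace of the Frechet filter on X is proper because X is infinite. *)
have FF : ProperFilter (within X \oo).
  apply: Build_ProperFilter => -[N _ XN].
  have [x Xx Nx] := infinite_nat_ge N Xinf; exact: (XN x Nx Xx).
have [U [UU XU]] := ultraFilterLemma FF.
have UX : U X by apply: XU; exact: withinT.
have Ugt x : U [set y | (x < y)%N].
  by apply: XU; exists x.+1 => // y /=.
have [b Ub] : exists b, U [set x | U [set y | c x y = b]].
  have [Ut|Uf] := in_ultra_setVsetC [set x | U [set y | c x y = true]] UU.
    by exists true.
  exists false; apply: filterS Uf => x /= Ux.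
  have [//|] := in_ultra_setVsetC [set y | c x y = true] UU.
  by apply: filterS => y /= /negP/negbTE.
pose A := X `&` [set x | U [set y | c x y = b]].
have [|f fP] := history_choice (P := fun s v => (forall x, x \in s -> A x) ->
    A v /\ forall x, x \in s -> (x < v)%N /\ c x v = b).
  move=> s; apply: (@filter_ex _ U).
  have [sA|/existsNP[x xs]] := pselect (forall x, x \in s -> A x); last first.
    by apply: filterE => v sA; case: xs; exact: sA.
  suff : U [set v | A v /\ forall x, x \in s -> (x < v)%N /\ c x v = b].
    by apply: filterS.
  apply: filterI; first exact: filterI.
  elim: s sA => [|x s IH] sA; first exact: filterE.
  have [|Xx Ux] := sA x; first by rewrite mem_head.
  have Us : U [set v | forall y, y \in s -> (y < v)%N /\ c y v = b].
    by apply: IH => y ys; apply: sA; rewrite in_cons ys orbT.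
  apply: filterS3 Us (Ugt x) Ux => v sv xv cxv y.
  by rewrite in_cons => /predU1P[->//|/sv].
have fA n : A (f n).
  have [m] := ubnP n; elim: m n => // m IH n nm.
  apply: (fP n _).1 => _ /mapP[i + ->]; rewrite mem_iota add0n => ni.
  by apply: IH; exact: leq_trans ni _.
have fc i j : (i < j)%N -> (f i < f j)%N /\ c (f i) (f j) = b.
  move=> ij; apply: (fP j _).2 => [_ /mapP[k _ ->]//|].
  by apply: map_f; rewrite mem_iota.
have fmono : {mono f : i j / (i < j)%N}.
  by apply: leqW_mono; apply: leq_mono => i j /fc[].
exists (range f), b; split.
- by move=> _ [n _ <-]; have [] := fA n.
- move=> /(@finite_preimage _ _ _ f) fin; apply: infinite_nat.
  apply: sub_finite_set (fin _) => [n _|i j _ _ fij]; first by exists n.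
  by case: (ltngtP i j) => // /fc[]; rewrite fij ltnn.
- by move=> _ _ [i _ <-] [j _ <-]; rewrite fmono => /fc[].
Qed.

Lemma random_ideal_is_ideal (E : rel nat) : is_ideal (random_ideal E).
Proof.
split=> [A Afin I [Iid _]|A B AB IB I [Iid EI]|A B IA IB I [Iid EI]].
- exact: (ideal_finite Iid Afin).
- exact: (ideal_subset Iid AB (IB I _)).
- exact: (ideal_union Iid (IA I _) (IB I _)).
Qed.

Lemma random_ideal_tall (E : rel nat) :
  random_graph E -> tall (random_ideal E).
Proof.
move=> hE X /(ramsey_pairs E)[Y [b [YX Yinf YE]]].
exists Y; split=> //; apply: sub_gen_smallest; case: b YE => YE; [left|right].
  move=> x y Yx Yy /eqP; rewrite neq_ltn => /orP[|] xy; first exact: YE.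
  by rewrite (rg_sym hE); exact: YE.
move=> x y Yx Yy; have [xy|xy|->] := ltngtP x y; last by rewrite (rg_irr hE).
  by rewrite YE.
by rewrite (rg_sym hE) YE.
Qed.

(** If f maps X to an infinite set, pull back a member of I inside f(X).
    Otherwise some fibre of f is infinite in X, and it is the preimage of a
    singleton, which belongs to I. *)
Lemma katetov_le_tall {I J : set (set nat)} :
  is_ideal I -> is_ideal J -> katetov_le I J -> tall I -> tall J.
Proof.
move=> Iid Jid [f fIJ] Itall X Xinf.
have [fXfin|/Itall[B [BfX Binf IB]]] := pselect (finite_set (f @` X)).
  have [|/existsNP[y /not_implyP[fXy yinf]]] := pselect
      (forall y, (f @` X) y -> finite_set (X `&` f @^-1` [set y])).
    move=> fib; case: Xinf; apply: sub_finite_set (bigcup_finite fXfin fib).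
    by move=> x Xx; exists (f x) => //; exists x.
  exists (X `&` f @^-1` [set y]); split=> //.
  apply: (ideal_subset Jid (@subIsetr _ _ _)) (fIJ _ _).
  by apply: (ideal_finite Iid); exact: finite_set1.
exists (X `&` f @^-1` B); split=> [|fin|]; first exact: subIsetl.
  apply: Binf; apply: sub_finite_set (finite_image f fin) => y By.
  by have [x Xx fxy] := BfX y By; exists x => //; split=> //=; rewrite fxy.
exact: (ideal_subset Jid (@subIsetr _ _ _)) (fIJ _ IB).
Qed.

(** The vertices f(0), f(1), ... are chosen by the extension property. They
    are distinct because the vertex given by [rg_ext] lies in neither of the
    two sets to which its adjacency is prescribed. *)
Lemma random_graph_universal {E : rel nat} (c : rel nat) : random_graph E ->
  exists2 f : nat -> nat, injective f &
    forall m n, (m < n)%N -> E (f m) (f n) = c m n.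
Proof.
move=> hE.
have [|f fP] := history_choice (P := fun s v => uniq s -> v \notin s /\
    forall i, (i < size s)%N -> E (nth 0%N s i) v = c i (size s)).
  move=> s; have [us|] := boolP (uniq s); last by exists 0%N.
  pose adj b := [set` [seq nth 0%N s i | i <- iota 0 (size s) & c i (size s) == b]].
  have adjP i : (i < size s)%N -> adj (c i (size s)) (nth 0%N s i).
    by move=> si; apply: map_f; rewrite mem_filter eqxx mem_iota.
  have [||//|v [vt vf Et Ef]] := rg_ext hE (A := adj true) (B := adj false).
  - exact: finite_seq.
  - exact: finite_seq.
  - rewrite -subset0 => _ [/= /mapP[i + ->] /mapP[j + /eqP]].
    rewrite !mem_filter !mem_iota /= => /andP[/eqP ci si] /andP[/eqP cj sj].
    by rewrite nth_uniq// => /eqP ij; rewrite ij cj in ci.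
  exists v => _; split=> [|i si].
    apply/negP => /(nthP 0%N)[i si iv].
    by case ci: (c i (size s)) (adjP i si); rewrite iv.
  rewrite (rg_sym hE); case: (c i (size s)) (adjP i si); first exact: Et.
  by move=> /Ef/negbTE.
have funiq n : uniq (mkseq f n).
  by elim: n => // n IH; rewrite mkseqS rcons_uniq IH (fP n IH).1.
exists f => [i j fij|m n mn].
  have := funiq (maxn i j).+1 => /(mkseq_uniqP f); apply=> //.
    by rewrite inE ltnS leq_maxl.
  by rewrite inE ltnS leq_maxr.
have := (fP n (funiq n)).2 m; rewrite size_mkseq nth_mkseq //; exact.
Qed.

(** An embedding f of the graph with colouring c in E pulls cliques and
    independent sets back to homogeneous sets, and the sets whose preimage is
    in J form an ideal; injectivity of f is what puts the finite sets in it. *)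
Lemma random_ideal_katetov_le (E c : rel nat) (J : set (set nat)) :
  random_graph E -> is_ideal J ->
  (forall H b, (forall m n, H m -> H n -> (m < n)%N -> c m n = b) -> J H) ->
  katetov_le (random_ideal E) J.
Proof.
move=> hE Jid Jc; have [f finj fE] := random_graph_universal c hE.
exists f; apply: smallest_sub => [|C].
  split=> [A Afin|A B AB|A B] /=.
  - apply: (ideal_finite Jid) (finite_preimage _ Afin).
    by move=> x y _ _; exact: finj.
  - by apply: (ideal_subset Jid); exact: preimage_subset.
  - by rewrite preimage_setU; exact: (ideal_union Jid).
move=> [|] CE /=; [apply: (Jc _ true)|apply: (Jc _ false)] => m n Cm Cn mn.
  rewrite -fE//; apply: CE => // /finj mn'; by rewrite mn' ltnn in mn.
by rewrite -fE//; apply/negbTE; exact: CE.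
Qed.

(** * Tallness forces the masses of points to vanish *)

Lemma FIN_is_ideal {R : realType} {phi : set nat -> \bar R} :
  lsc_submeasure phi -> is_ideal (FIN phi).
Proof.
move=> phi_lsc.
have union A B : FIN phi A -> FIN phi B -> FIN phi (A `|` B).
  move=> Afin Bfin; apply: le_lt_trans (lscs_subadd phi_lsc A B) _.
  exact: lte_add_pinfty.
have subset A B : A `<=` B -> FIN phi B -> FIN phi A.
  move=> AB; apply: le_lt_trans; rewrite -((setUidPr _ _).2 AB).
  exact: lscs_le.
split=> // A /finite_natP[N] AN; apply: subset AN _.
elim: N => [|n IH]; first by rewrite II0 /FIN /= lscs_set0 ?ltry.
by rewrite IIS; apply: union => //; exact: lscs_fin.
Qed.

(** Removing one point leaves an infinite set with the same property, so
    N e <= mu(A) for every N by induction. *)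
Lemma measure_infinite_ge (R : realType) (mu : {measure set nat -> \bar R})
    (e : R) (A : set nat) : 0 < e -> infinite_set A ->
  (forall n, A n -> (e%:E <= mu [set n])%E) -> mu A = +oo%E.
Proof.
move=> e0 Ainf Ae.
have geN N : ((N%:R * e)%:E <= mu A)%E.
  elim: N A Ainf Ae => [|N IH] A Ainf Ae; first by rewrite mul0r.
  have [a Aa] := infinite_setN0 Ainf.
  rewrite -(setD1K Aa) measureU//; last by rewrite setDE setICA setICr setI0.
  rewrite mulrSr mulrDl mul1r EFinD addeC; apply: leeD; first exact: Ae.
  apply: IH => [|n [/Ae]//]; apply: infinite_setD => //; exact: finite_set1.
apply/eqyP => r r0; apply: le_trans (geN (Num.truncn (r / e)).+1).
by rewrite lee_fin -ler_pdivrMr// ltW// truncnS_gt.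
Qed.

Lemma tall_vanishing {R : realType} {phi : set nat -> \bar R}
    {mu : {measure set nat -> \bar R}} :
  (forall A, mu A <= phi A)%E -> tall (FIN phi) ->
  mu [set n] @[n --> \oo] --> 0%E.
Proof.
move=> mu_phi phi_tall; apply/cvge0_finiteP => [//|e e0].
apply: contrapT => /phi_tall[A [Ae Ainf]]; apply/negP; rewrite -leNgt.
by rewrite (le_trans _ (mu_phi A))// (@measure_infinite_ge _ _ e).
Qed.

(** Otherwise choose points f(n) with phi{f(n)} > n. By monotonicity a set of
    finite phi contains f(n) for only finitely many n. *)
Lemma tall_bounded (R : realType) (phi : set nat -> \bar R) :
  lsc_submeasure phi -> tall (FIN phi) ->
  (ereal_sup (range (fun n : nat => phi [set n])) < +oo)%E.
Proof.
move=> phi_lsc phi_tall; have phi_ideal := FIN_is_ideal phi_lsc.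
have mono A B : A `<=` B -> (phi A <= phi B)%E.
  by move=> AB; rewrite -((setUidPr _ _).2 AB); exact: lscs_le.
rewrite ltey; apply/eqP => sup_oo.
have /choice[f fP] (n : nat) : exists m, (n%:R%:E < phi [set m])%E.
  have /ereal_sup_gt[_ [m _ <-] ?] : (n%:R%:E <
    ereal_sup (range (fun n : nat => phi [set n])))%E by rewrite sup_oo ltry.
  by exists m.
have bounded_index (A : set nat) : FIN phi A -> exists N,
    forall n, A (f n) -> (n < N)%N.
  move=> Afin; have phiA : phi A \is a fin_num.
    by rewrite ge0_fin_numE// lscs_ge0.
  exists (Num.truncn (fine (phi A))).+1 => n Afn.
  rewrite -(ltr_nat R) (le_lt_trans _ (truncnS_gt _))//.
  rewrite -lee_fin fineK// ltW// (lt_le_trans (fP n))//; apply: mono => _ ->//.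
have finf : infinite_set (range f).
  move=> /(ideal_finite phi_ideal)/bounded_index[N fN].
  by have := fN N; rewrite ltnn => /(_ (imageT f N)).
have [A [Af Ainf /bounded_index[N AN]]] := phi_tall _ finf.
apply: Ainf; apply: (@sub_finite_set _ _ (f @` `I_N)).
  by move=> a Aa; have [n _ fn] := Af a Aa; exists n => //; apply: AN; rewrite fn.
exact/finite_image/finite_II.
Qed.

(** * A colouring of pairs whose homogeneous sets have finite submeasure *)

(** The threshold is the same 2^-m on both sides: the first occurrence makes
    the masses below it summable along a set, and the second makes the mass of
    each further large point summable against the preceding large point. *)
Definition tame {R : realType} (mu : nat -> {measure set nat -> \bar R}) :
    rel nat :=
  fun m n => `[< forall k, ((2^-1 ^+ m)%:E < mu k [set m])%E ->
                           (mu k [set n] <= (2^-1 ^+ m)%:E)%E >].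

(** The bound is uniform in k and n, as is needed to pass to the supremum of
    the measures and then to the limit given by lower semicontinuity. *)
Lemma tame_homogeneous_bound (R : realType)
    (mu : nat -> {measure set nat -> \bar R}) (M : R) (H : set nat) k n :
  0 <= M -> (forall n, mu k [set n] <= M%:E)%E ->
  (forall m n, H m -> H n -> (m < n)%N -> tame mu m n) ->
  (mu k (H `&` `I_n) <= (M + 4)%:E)%E.
Proof.
move=> M0 muM tameH.
(* G i is the geometric sum of the eps j for j < i. *)
pose eps i : R := 2^-1 ^+ i; pose G i : R := 2 - 2 * eps i.
have eps0 i : 0 < eps i by rewrite exprn_gt0// invr_gt0.
have GS i : G i.+1 = G i + eps i by rewrite /G /eps exprS; lra.
have Gle i j : (i <= j)%N -> G i <= G j.
  by move=> /subnK<-; elim: (j - i)%N => // d IH; rewrite addSn GS ler_wpDr// ltW.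
have G2 i : G i <= 2 by rewrite /G; have := eps0 i; lra.
pose heavy h := H h /\ ((eps h)%:E < mu k [set h])%E.
(* Below n, the light points cost at most G n. The first heavy point costs at
   most M, and the later heavy points cost at most the sum of the eps over
   their heavy predecessors, all of which lie before the last heavy point h. *)
suff [[_ Sn]|[h [_ _ Sn]]] :
    ((forall h, (h < n)%N -> ~ heavy h) /\ (mu k (H `&` `I_n) <= (G n)%:E)%E) \/
    (exists h, [/\ (h < n)%N, heavy h &
                   (mu k (H `&` `I_n) <= (M + G n + G h)%:E)%E]).
- by apply: le_trans Sn _; rewrite lee_fin; have := G2 n; lra.
- by apply: le_trans Sn _; rewrite lee_fin; have := G2 n; have := G2 h; lra.
elim: n => [|n IH].
  by left; split=> //; rewrite II0 setI0 measure0 lee_fin /G /eps expr0; lra.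
have step (a b : R) : (mu k (H `&` `I_n) <= a%:E)%E ->
    (H n -> (mu k [set n] <= b%:E)%E) -> 0 <= b ->
    (mu k (H `&` `I_n.+1) <= (a + b)%:E)%E.
  move=> Sa Hb b0; rewrite IIS setIUr EFinD.
  apply: le_trans (measureU2 _ _ _) _ => //; apply: leeD Sa _.
  have [Hn|Hn] := pselect (H n).
    by apply: le_trans (Hb Hn); apply: le_measure; rewrite ?inE//; exact: subIsetr.
  rewrite (_ : _ `&` _ = set0) ?measure0// -subset0 => x [Hx xn].
  by rewrite -xn in Hn.
have [nheavy|nlight] := pselect (heavy n).
  right; exists n; split=> //; have [Hn _] := nheavy.
  case: IH => [[_ Sn]|[h [hn [Hh heavyh] Sn]]].
    apply: le_trans (step _ M Sn _ M0) _ => //; rewrite lee_fin GS.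
    have G0 : 0 <= G n by have := Gle _ _ (leq0n n); rewrite {1}/G /eps expr0; lra.
    by have := eps0 n; lra.
  have /asboolP/(_ k heavyh) mun := tameH _ _ Hh Hn hn.
  apply: le_trans (step _ (eps h) Sn (fun=> mun) (ltW (eps0 h))) _; rewrite lee_fin.
  have := Gle _ _ hn; have := eps0 n; rewrite !GS; lra.
have light : H n -> (mu k [set n] <= (eps n)%:E)%E.
  by move=> Hn; rewrite leNgt; apply/negP => ?; apply: nlight.
case: IH => [[nh Sn]|[h [hn heavyh Sn]]]; [left|right].
  split; last by rewrite GS; exact: step Sn light (ltW _).
  by move=> h; rewrite ltnS leq_eqVlt => /predU1P[->|/nh].
exists h; split=> //; first exact: ltnW.
apply: le_trans (step _ _ Sn light (ltW (eps0 n))) _; rewrite lee_fin GS; lra.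
Qed.

(** If m and n in H are joined by the wild colour, m < n, then n has large mass
    for one of the finitely many measures that are large at m. *)
Lemma wild_homogeneous_finite {R : realType}
    {mu : nat -> {measure set nat -> \bar R}} {H : set nat} :
  type_c0 mu -> (forall k, mu k [set n] @[n --> \oo] --> 0%E) ->
  (forall m n, H m -> H n -> (m < n)%N -> ~~ tame mu m n) ->
  finite_set H.
Proof.
move=> mu_c0 mu0 wildH; apply: contrapT => Hinf.
have [m Hm] := infinite_setN0 Hinf.
have e0 : 0 < 2^-1 ^+ m :> R by rewrite exprn_gt0// invr_gt0.
pose large k : set nat := [set n | ((2^-1 ^+ m)%:E <= mu k [set n])%E].
have /infinite_setN0[n [Hn]] : infinite_set
    (H `\` (`I_m.+1 `|` \bigcup_(k in [set k | large k m]) large k)).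
  apply: infinite_setD => //; rewrite finite_setU; split; first exact: finite_II.
  apply: bigcup_finite => [|k _].
    exact: ((cvge0_finiteP (fun k => measure_ge0 (mu k) [set m])).1 (mu_c0 m)).
  exact: ((cvge0_finiteP (fun n => measure_ge0 (mu k) [set n])).1 (mu0 k)).
move=> /not_orP[/negP]; rewrite -leqNgt => mn; apply.
have /asboolPn/existsNP[k /not_implyP[kheavy /negP]] := wildH _ _ Hm Hn mn.
by rewrite -ltNge => /ltW ?; exists k => //; exact: ltW.
Qed.

Theorem theorem4p10 (R : realType) (E : rel nat) (hE : random_graph E)
    (mu : nat -> {measure set nat -> \bar R}) (phi : set nat -> \bar R)
    (mu_c0 : type_c0 mu) (phiE : phi = sup_measure mu)
    (phi_lsc : lsc_submeasure phi) :
  (katetov_le (random_ideal E) (FIN phi) <-> tall (FIN phi)) /\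
  (tall (FIN phi) <->
     ((forall k, mu k [set n] @[n --> \oo] --> 0%E) /\
      (ereal_sup (range (fun n : nat => phi [set n])) < +oo)%E)).
Proof.
have phi_ideal := FIN_is_ideal phi_lsc.
have mu_phi k A : (mu k A <= phi A)%E.
  by rewrite phiE; apply: ereal_sup_ubound; exists k.
have i_ii : katetov_le (random_ideal E) (FIN phi) -> tall (FIN phi).
  move=> le_phi; apply: katetov_le_tall phi_ideal le_phi _.
    exact: random_ideal_is_ideal.
  exact: random_ideal_tall.
have ii_iii : tall (FIN phi) ->
    (forall k, mu k [set n] @[n --> \oo] --> 0%E) /\
    (ereal_sup (range (fun n : nat => phi [set n])) < +oo)%E.
  move=> phi_tall; split=> [k|]; last exact: tall_bounded.
  exact: tall_vanishing (mu_phi k) phi_tall.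
have iii_i : (forall k, mu k [set n] @[n --> \oo] --> 0%E) /\
    (ereal_sup (range (fun n : nat => phi [set n])) < +oo)%E ->
    katetov_le (random_ideal E) (FIN phi).
  move=> [mu0]; set S := ereal_sup _ => Sfin.
  have phi_le n : (phi [set n] <= S)%E by apply: ereal_sup_ubound; exists n.
  have S0 : (0 <= S)%E := le_trans (lscs_ge0 phi_lsc _) (phi_le 0%N).
  have SE : (fine S)%:E = S by rewrite fineK// ge0_fin_numE.
  apply: (random_ideal_katetov_le _ (tame mu)) => // H [] tameH; last first.
    apply: (ideal_finite phi_ideal).
    by apply: wild_homogeneous_finite mu_c0 mu0 _ => m n Hm Hn /tameH->.
  apply: (@le_lt_trans _ _ (fine S + 4)%:E); last exact: ltry.
  apply: (cvge_le _ (lscs_cvg phi_lsc (A := H))); near=> n.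
  rewrite phiE; apply: ge_ereal_sup => _ [k _ <-].
  apply: (@tame_homogeneous_bound _ mu _ _ k n.+1) => //.
    exact: fine_ge0.
  by move=> m; rewrite SE; exact: le_trans (mu_phi k _) (phi_le m).
split; split=> //; first by move=> /ii_iii/iii_i.
by move=> /iii_i/i_ii.
Unshelve. all: by end_near. Qed.
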